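(* Let $\mathfrak{L}$ be a linearly ordered idempotent semifield with $\mathfrak{L}\neq\mathbb{B}$. For any idempotent $E\in UT_4(\mathfrak{L}^* )$, the $\widetilde{\mathcal{H}}$-class $\widetilde{H}_E$ of $E$ in $UT_4(\mathfrak{L}^* )$ is a subsemigroup.
   Context: A linearly ordered idempotent semifield is a commutative semiring $\mathfrak{L}$ with $x+x=x$ for all $x$, in which $\mathfrak{L}^*=\mathfrak{L}\setminus\{\mathbf{0}\}$ is an abelian group under multiplication, and in which the order $a\leq b\iff a+b=b$ is total (so addition is maximum). $\mathbb{B}$ is the two-element Boolean semifield. $UT_4(\mathfrak{L}^* )$ is the semigroup (under matrix multiplication) of upper triangular $4\times 4$ matrices over $\mathfrak{L}$ all of whose entries on and above the diagonal are non-zero. For a semigroup $T$: $a\,\widetilde{\mathcal{R}}\,b$ iff for all idempotents $e\in T$, $ea=a\Leftrightarrow eb=b$; $a\,\widetilde{\mathcal{L}}\,b$ iff for all idempotents $e\in T$, $ae=a\Leftrightarrow be=b$; $\widetilde{\mathcal{H}}=\widetilde{\mathcal{R}}\cap\widetilde{\mathcal{L}}$. *)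

(* Defs.v *)
From HB Require Import structures.
From mathcomp Require Import all_boot all_order all_algebra.

Set Implicit Arguments.
Unset Strict Implicit.
Unset Printing Implicit Defensive.

Import GRing.Theory.
Local Open Scope ring_scope.

(* A boolean relation, so that [total] from ssrbool applies. *)
Definition idem_le (V : nmodType) : rel V := fun a b => a + b == b.

(* The nonzero elements of a commutative semiring form an abelian group as soon
   as 1 is nonzero (part of GRing.ComNzSemiRing) and nonzero elements have
   nonzero inverses: closure under product then follows. *)
HB.mixin Record isLinOrdIdemSemifield L of GRing.ComNzSemiRing L := {
  addrr_idem : forall x : L, x + x = x;
  mulVr_exists : forall x : L, x != 0 -> exists2 y : L, y != 0 & y * x = 1;
  idem_le_total : total (@idem_le L)
}.

#[short(type="linOrdIdemSemifieldType")]
HB.structure Definition LinOrdIdemSemifield :=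
  {L of isLinOrdIdemSemifield L & GRing.ComNzSemiRing L}.

(* An alias is needed: [bool] itself carries the canonical structure of the
   field with two elements, whose addition is [addb]. *)
Definition boolSemifield : Type := bool.

HB.instance Definition _ := Choice.on boolSemifield.

HB.instance Definition _ :=
  GRing.isNmodule.Build boolSemifield orbA orbC orFb.

HB.instance Definition _ :=
  GRing.Nmodule_isComNzSemiRing.Build boolSemifield
    andbA andbC andTb andb_orl andFb isT.

Fact boolSemifield_addrr (x : boolSemifield) : x + x = x.
Proof. exact: orbb. Qed.

Fact boolSemifield_mulVr (x : boolSemifield) :
  x != 0 -> exists2 y : boolSemifield, y != 0 & y * x = 1.
Proof. by case: x => // _; exists true. Qed.

Fact boolSemifield_total : total (@idem_le boolSemifield).
Proof. by do 2!case. Qed.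

HB.instance Definition _ := isLinOrdIdemSemifield.Build boolSemifield
  boolSemifield_addrr boolSemifield_mulVr boolSemifield_total.

(* Semiring isomorphism; {rmorphism L -> M} preserves 0, +, 1 and *. *)
Definition semiring_iso (L M : pzSemiRingType) : Prop :=
  exists f : {rmorphism L -> M}, bijective f.

Section UpperTriangularNonzero.

Variables (L : linOrdIdemSemifieldType) (n : nat).

(* The membership predicate of UT_n(L^* ): the product of two such matrices is
   again such, since a sum in L vanishes only when all its terms do. *)
Definition is_utnz (A : 'M[L]_n) : bool :=
  [forall i : 'I_n, forall j : 'I_n,
     if (j < i)%N then A i j == 0 else A i j != 0].

Record utnz : Type := Utnz { utnz_mx :> 'M[L]_n; _ : is_utnz utnz_mx }.

HB.instance Definition _ := [isSub for utnz_mx].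
HB.instance Definition _ := [Choice of utnz by <:].

Lemma idem_addr_eq0 (a b : L) : (a + b == 0) = (a == 0) && (b == 0).
Proof.
apply/eqP/andP => [ab0|[/eqP-> /eqP->]]; last by rewrite addr0.
have a0 : a = 0 by rewrite -[LHS]addr0 -[in LHS]ab0 addrA addrr_idem ab0.
by move: ab0; rewrite a0 add0r => ->.
Qed.

Lemma idem_mulr_neq0 (a b : L) : a != 0 -> b != 0 -> a * b != 0.
Proof.
move=> /mulVr_exists[c _ ca1] /negP bn0; apply/negP => /eqP ab0.
by apply: bn0; rewrite -[b]mul1r -ca1 -mulrA ab0 mulr0.
Qed.

Lemma is_utnz_mulmx (A B : 'M[L]_n) :
  is_utnz A -> is_utnz B -> is_utnz (A *m B).
Proof.
move=> /'forall_forallP utA /'forall_forallP utB.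
apply/'forall_forallP => i j; rewrite mxE; case: ltnP => [lt_ji|le_ij].
  apply/eqP/big1 => k _; case: (ltnP k i) => [lt_ki|le_ik].
    by have := utA i k; rewrite lt_ki => /eqP->; rewrite mul0r.
  by have := utB k j; rewrite (leq_trans lt_ji le_ik) => /eqP->; rewrite mulr0.
rewrite (bigD1 i) //= idem_addr_eq0 negb_and.
have := utA i i; rewrite ltnn => Aii.
have := utB i j; rewrite ltnNge le_ij /= => Bij.
by rewrite idem_mulr_neq0.
Qed.

Definition utnz_mul (A B : utnz) : utnz :=
  Utnz (is_utnz_mulmx (valP A) (valP B)).

Fact utnz_mulA : associative utnz_mul.
Proof. by move=> A B C; apply/val_inj; rewrite /= mulmxA. Qed.

HB.instance Definition _ := isSemigroup.Build utnz utnz_mulA.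

End UpperTriangularNonzero.

Section TildeRelations.

Variable T : semigroupType.
Local Open Scope group_scope.

Definition idempotent_elt (e : T) : Prop := e * e = e.

Definition tildeR (a b : T) : Prop :=
  forall e : T, idempotent_elt e -> (e * a = a <-> e * b = b).

Definition tildeL (a b : T) : Prop :=
  forall e : T, idempotent_elt e -> (a * e = a <-> b * e = b).

Definition tildeH (a b : T) : Prop := tildeR a b /\ tildeL a b.

Definition tildeH_class (a : T) : T -> Prop := fun b => tildeH a b.

(* A Prop-valued analogue of [mulg_closed], together with nonemptiness. *)
Definition subsemigroup (S : T -> Prop) : Prop :=
  (exists a, S a) /\ (forall a b, S a -> S b -> S (a * b)).

End TildeRelations.

(* Main.v *)
Require Import Defs.
From HB Require Import structures.
From mathcomp Require Import all_boot all_order all_algebra.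

(** Write [a <= b] for [a + b = b] and let [A] be a matrix in [UT_n(L^* )].
    For [i <= j], among the [c] with [c * A j k <= A i k] for all [k] there is a
    largest one, [R i j], the minimum over [k >= j] of the quotients of [A i k] by [A j k];
    residuation makes [R] idempotent.  An idempotent [F] fixes [A] on the left
    if and only if [F <= R] entrywise, so [A] is R~-related to an idempotent [E]
    exactly when [R = E].  As a condition on entries ([tildeR_row_tight]):
    [E A = A], and each inequality [E i j * A j k <= A i k] with [i < j] becomes
    an equality for some [k >= j].  Reflection in the antidiagonal, [dual], is
    an anti-automorphism, and turns this into the criterion for L~.

    For n = 4, index rows and columns by 0, 1, 2, 3, and let [A] be in the
    H~-class of [E].  In the last column the row condition, and in the first row
    the column condition, admits only one witness, so these lines are scalar
    multiples of those of [E], by [A 3 3] and [A 0 0]; comparing the corner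
    shows that the scalars agree.  The remaining inequalities are those
    at (0,1), (0,2) and (1,2).  For each such (i,j), either
    [E i 3 = E i j * E j 3], a condition on [E] alone which makes every matrix
    with the right last column tight at [k = 3], or else both factors [A] and
    [B] satisfy one and the same equation between entries, which passes to the
    product ([row_tight_mul]).  Applying this to the reflected matrices gives
    the L~ half. *)

Set Implicit Arguments.
Unset Strict Implicit.
Unset Printing Implicit Defensive.

Import GRing.Theory.

(** * The order of an idempotent semifield *)

Section SemifieldOrder.

Variable L : linOrdIdemSemifieldType.
Local Open Scope ring_scope.
Implicit Types a b c : L.

Lemma idem_le_refl : reflexive (@idem_le L).
Proof. by move=> a; rewrite /idem_le addrr_idem. Qed.

Lemma idem_le_trans : transitive (@idem_le L).
Proof.
by move=> b a c /eqP ab /eqP bc; rewrite /idem_le -bc addrA ab.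
Qed.

Lemma idem_le_anti a b : idem_le a b -> idem_le b a -> a = b.
Proof. by move=> /eqP ab /eqP; rewrite addrC ab. Qed.

Lemma idem_le0 a : idem_le 0 a.
Proof. by rewrite /idem_le add0r. Qed.

Lemma idem_le_mul2l c a b : idem_le a b -> idem_le (c * a) (c * b).
Proof. by rewrite /idem_le -mulrDr => /eqP ->. Qed.

Lemma semifield_mulfI c : c != 0 -> injective ( *%R c).
Proof.
case/mulVr_exists=> d _ dc a b /(congr1 ( *%R d)).
by rewrite !mulrA dc !mul1r.
Qed.

Lemma semifield_mulIf c : c != 0 -> injective ( *%R^~ c).
Proof. by move=> c0 a b /=; rewrite ![_ * c]mulrC; apply: semifield_mulfI. Qed.

Lemma idem_le_pmul2r c a b : c != 0 -> idem_le (a * c) (b * c) -> idem_le a b.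
Proof.
move=> c0; rewrite /idem_le -mulrDl => /eqP e; apply/eqP.
exact: (semifield_mulIf c0 e).
Qed.

Lemma idem_le_sum (I : finType) (F : I -> L) i : idem_le (F i) (\sum_j F j).
Proof. by rewrite /idem_le (bigD1 i) //= addrA addrr_idem. Qed.

Lemma sum_idem_le (I : finType) (F : I -> L) b :
  (forall i, idem_le (F i) b) -> idem_le (\sum_i F i) b.
Proof.
move=> Fb; elim/big_rec: _ => [|i x _ /eqP xb]; first exact: idem_le0.
by rewrite /idem_le -addrA xb; apply: Fb.
Qed.

End SemifieldOrder.

(** * Idempotents and the relation R~ *)

Section Triangular.

Variables (L : linOrdIdemSemifieldType) (n : nat).
Local Open Scope ring_scope.
Implicit Types A B E F : utnz L n.

Lemma utnz_eq0 A (i j : 'I_n) : (j < i)%N -> A i j = 0.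
Proof.
by move=> ji; have /'forall_forallP/(_ i j) := valP A; rewrite ji => /eqP.
Qed.

Lemma utnz_neq0 A (i j : 'I_n) : (i <= j)%N -> A i j != 0.
Proof.
by move=> ij; have /'forall_forallP/(_ i j) := valP A; rewrite ltnNge ij.
Qed.

Lemma utnz_mulE A B i k : (A * B)%g i k = \sum_j A i j * B j k.
Proof. by rewrite [LHS]mxE. Qed.

Lemma utnz_ext A B : (forall i j, A i j = B i j) -> A = B.
Proof. by move=> AB; apply/val_inj/matrixP. Qed.

Lemma utnz_mul_diag A B i : (A * B)%g i i = A i i * B i i.
Proof.
rewrite utnz_mulE (bigD1 i) //= big1 ?addr0 // => k ki.
case: (ltngtP k i) => [lt|lt|eq]; first by rewrite utnz_eq0 ?mul0r.
  by rewrite (utnz_eq0 B) ?mulr0.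
by rewrite (ord_inj eq) eqxx in ki.
Qed.

Lemma idempotent_diag E i : idempotent_elt E -> E i i = 1.
Proof.
move=> EE; apply: (semifield_mulfI (utnz_neq0 E (leqnn i))).
by rewrite mulr1 -utnz_mul_diag EE.
Qed.

Lemma utnz_mul_le F A :
  (F * A)%g = A -> forall i j k, idem_le (F i j * A j k) (A i k).
Proof.
move=> FA i j k; rewrite -[X in idem_le _ (fun_of_matrix (utnz_mx X) _ _)]FA.
rewrite utnz_mulE.
exact: (idem_le_sum (fun j => F i j * A j k)).
Qed.

Lemma utnz_mul_id F A : (forall i, F i i = 1) ->
  (forall i j k, idem_le (F i j * A j k) (A i k)) -> (F * A)%g = A.
Proof.
move=> F1 FA; apply: utnz_ext => i k; apply: idem_le_anti.
  by rewrite utnz_mulE; apply: sum_idem_le => j; apply: FA.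
rewrite utnz_mulE -{1}[A i k]mul1r -(F1 i).
exact: (idem_le_sum (fun j => F i j * A j k)).
Qed.

(** This [c] is the minimum over [k >= j] of the quotients of [A i k] by
    [A j k]: minimality bounds it below the other quotients, and the index
    attaining it gives the equality. *)
Lemma residual_entry A (i j : 'I_n) : (i <= j)%N ->
  exists c, [/\ c != 0, forall k, idem_le (c * A j k) (A i k)
    & exists2 k : 'I_n, (j <= k)%N & A i k = c * A j k].
Proof.
move=> ij.
have inv_ex (k : 'I_n) : exists y : L, (j <= k)%N -> y != 0 /\ y * A j k = 1.
  case: (leqP j k) => [jk|_]; last by exists 0.
  by have [y y0 yA] := mulVr_exists _ (utnz_neq0 A jk); exists y.
have [y yP] := fin_all_exists inv_ex.
pose q k := A i k * y k.
have qK (k : 'I_n) : (j <= k)%N -> q k * A j k = A i k.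
  by case/yP=> _ yA; rewrite /q -mulrA yA mulr1.
have [k jk kmin] := @extremumP _ _ (@idem_le L) j (fun k : 'I_n => (j <= k)%N)
  q (@idem_le_refl L) (@idem_le_trans L) (@idem_le_total L) (leqnn j).
exists (q k); split; last by exists k; rewrite ?qK.
  by apply: idem_mulr_neq0; [apply/utnz_neq0/(leq_trans ij)|case: (yP k jk)].
move=> l; case: (leqP j l) => [jl|lj].
  by rewrite -[A i l]qK // ![_ * A j l]mulrC idem_le_mul2l // kmin.
by rewrite (utnz_eq0 A lj) mulr0 idem_le0.
Qed.

(** The left residual of [A] by itself, the largest idempotent fixing [A] on
    the left. *)
Lemma residual_exists A : exists R : utnz L n,
  [/\ idempotent_elt R, (R * A)%g = A
    & forall i j : 'I_n, (i <= j)%N ->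
        exists2 k : 'I_n, (j <= k)%N & A i k = R i j * A j k].
Proof.
pose P (i j : 'I_n) c := if (j < i)%N then c = 0 else
  [/\ c != 0, forall k, idem_le (c * A j k) (A i k)
    & exists2 k : 'I_n, (j <= k)%N & A i k = c * A j k].
have Pex i j : exists c, P i j c.
  rewrite /P; case: ltnP => [_|ij]; first by exists 0.
  exact: residual_entry.
have [r rP] := fin_all_exists (fun i => fin_all_exists (Pex i)).
have utR : is_utnz (\matrix_(i, j) r i j).
  apply/'forall_forallP=> i j; have := rP i j; rewrite /P mxE.
  by case: ltnP => [_ ->|_ []].
pose R := Utnz utR.
have RE i j : R i j = r i j by rewrite [LHS]mxE.
have tight (i j : 'I_n) : (i <= j)%N ->
    exists2 k : 'I_n, (j <= k)%N & A i k = R i j * A j k.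
  by move=> ij; have := rP i j; rewrite /P ltnNge ij RE => -[].
have Rle i j k : idem_le (R i j * A j k) (A i k).
  have := rP i j; rewrite /P RE; case: ltnP => [_ ->|_ [] //].
  by rewrite mul0r idem_le0.
have R1 i : R i i = 1.
  have [k ik e] := tight i i (leqnn i).
  by apply: (semifield_mulIf (utnz_neq0 A ik)); rewrite mul1r.
exists R; split=> //; last exact: utnz_mul_id.
apply: utnz_mul_id => // i j l.
case: (leqP i j) => [ij|ji]; last by rewrite (utnz_eq0 R ji) mul0r idem_le0.
case: (leqP j l) => [jl|lj]; last by rewrite (utnz_eq0 R lj) mulr0 idem_le0.
(* Compare both sides after multiplying by the entry at which (i,l) is tight. *)
have [k lk e] := tight i l (leq_trans ij jl).
apply: (idem_le_pmul2r (utnz_neq0 A lk)); rewrite -e -mulrA.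
exact: idem_le_trans (idem_le_mul2l _ (Rle _ _ _)) (Rle _ _ _).
Qed.

Definition row_tight E A := forall i j : 'I_n, (i < j)%N ->
  exists2 k : 'I_n, (j <= k)%N & A i k = E i j * A j k.

Definition col_tight E A := forall i j : 'I_n, (i < j)%N ->
  exists2 k : 'I_n, (k <= i)%N & A k j = A k i * E i j.

(** The two conditions on the right say that [E] lies below the residual of [A]
    and is not exceeded by it in any entry. *)
Lemma tildeR_row_tight E A : idempotent_elt E ->
  tildeR E A <-> (E * A)%g = A /\ row_tight E A.
Proof.
move=> EE; split=> [RA|[EA tight] F FF].
  have EA : (E * A)%g = A by apply/(RA E EE).
  split=> // i j ij.
  have [R [RR RAA tight]] := residual_exists A.
  have RE : (R * E)%g = E by apply/(RA R RR).
  have [k jk e] := tight i j (ltnW ij).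
  exists k; rewrite // e; congr (_ * _); apply: idem_le_anti.
    have := utnz_mul_le RE i j j.
    by rewrite (idempotent_diag _ EE) mulr1.
  by apply: (idem_le_pmul2r (utnz_neq0 A jk)); rewrite -e; apply: utnz_mul_le.
split=> [FE|FA]; first by rewrite -EA mulgA FE.
have F1 i := idempotent_diag i FF.
apply: utnz_mul_id => // i j k.
case: (ltngtP i j) => [ij|ji|/ord_inj <-].
- have [l jl e] := tight i j ij.
  have FEij : idem_le (F i j) (E i j).
    apply: (idem_le_pmul2r (utnz_neq0 A jl)); rewrite -e.
    exact: utnz_mul_le.
  apply: idem_le_trans (utnz_mul_le EE i j k).
  by rewrite ![_ * E j k]mulrC idem_le_mul2l.
- by rewrite (utnz_eq0 F ji) mul0r idem_le0.
- by rewrite F1 mul1r idem_le_refl.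
Qed.

(** * Reflection in the antidiagonal *)

Lemma is_utnz_dual A : is_utnz (\matrix_(i, j) A (rev_ord j) (rev_ord i)).
Proof.
apply/'forall_forallP=> i j; rewrite mxE; case: ltnP => [ji|ij].
  by rewrite utnz_eq0 //= ltn_sub2l // (leq_trans _ (ltn_ord i)).
by rewrite utnz_neq0 //= leq_sub2l.
Qed.

Definition dual A : utnz L n := Utnz (is_utnz_dual A).

Lemma dualE A i j : dual A i j = A (rev_ord j) (rev_ord i).
Proof. by rewrite [LHS]mxE. Qed.

Lemma dualK : involutive dual.
Proof. by move=> A; apply: utnz_ext => i j; rewrite !dualE !rev_ordK. Qed.

Lemma dualM A B : dual (A * B)%g = (dual B * dual A)%g.
Proof.
apply: utnz_ext => i j; rewrite dualE !utnz_mulE (reindex_inj rev_ord_inj) /=.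
by apply: eq_bigr => k _; rewrite !dualE mulrC.
Qed.

Lemma dual_idempotent E : idempotent_elt E -> idempotent_elt (dual E).
Proof. by move=> EE; rewrite /idempotent_elt -dualM EE. Qed.

Lemma tildeL_of_dual A B : tildeR (dual A) (dual B) -> tildeL A B.
Proof.
move=> AB e /dual_idempotent/AB; rewrite -!dualM => -[AB1 AB2].
split=> [Ae|Be]; apply: (inv_inj dualK).
  by apply: AB1; rewrite Ae.
by apply: AB2; rewrite Be.
Qed.

Lemma tildeR_of_dual A B : tildeL (dual A) (dual B) -> tildeR A B.
Proof.
move=> AB e /dual_idempotent/AB; rewrite -!dualM => -[AB1 AB2].
split=> [Ae|Be]; apply: (inv_inj dualK).
  by apply: AB1; rewrite Ae.
by apply: AB2; rewrite Be.
Qed.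

Lemma tildeH_dual A B : tildeH A B -> tildeH (dual A) (dual B).
Proof.
by case=> R Lt; split; [apply: tildeR_of_dual|apply: tildeL_of_dual];
  rewrite !dualK.
Qed.

Lemma tildeL_col_tight E A : idempotent_elt E -> tildeL E A -> col_tight E A.
Proof.
move=> EE EA i j ij.
have RA : tildeR (dual E) (dual A) by apply: tildeR_of_dual; rewrite !dualK.
have [_ tight] := (tildeR_row_tight _ (dual_idempotent EE)).1 RA.
have [|k jk] := tight (rev_ord j) (rev_ord i).
  by rewrite /= ltn_sub2l // (leq_ltn_trans ij).
rewrite !dualE !rev_ordK mulrC => e; exists (rev_ord k) => //.
by rewrite -[X in (_ <= X)%N](congr1 val (rev_ordK i)) /= leq_sub2l.
Qed.

(** * Products of matrices proportional to the idempotent *)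

(** A column of [B] proportional to that of [E] is seen by [A] as a column of
    [E], which it reproduces up to the scalar since [A E = A]. *)
Lemma mul_prop_col E A B (i j : 'I_n) : (A * E)%g = A ->
  (forall k : 'I_n, (i <= k <= j)%N -> B k j = E k j * B j j) ->
  (A * B)%g i j = A i j * B j j.
Proof.
move=> AE Bj; rewrite -[in RHS]AE !utnz_mulE big_distrl /=.
apply: eq_bigr => k _.
case: (leqP i k) => [ik|ki]; last by rewrite (utnz_eq0 A ki) !mul0r.
case: (leqP k j) => [kj|jk]; first by rewrite Bj ?ik // mulrA.
by rewrite (utnz_eq0 B jk) (utnz_eq0 E jk) mulr0 mul0r.
Qed.

Lemma mul_prop_row E A B (i j : 'I_n) : (E * B)%g = B ->
  (forall k : 'I_n, (i <= k <= j)%N -> A i k = A i i * E i k) ->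
  (A * B)%g i j = A i i * B i j.
Proof.
move=> EB Ai; rewrite -[in RHS]EB !utnz_mulE big_distrr /=.
apply: eq_bigr => k _; rewrite mulrA.
case: (leqP i k) => [ik|ki].
  case: (leqP k j) => [kj|jk]; first by rewrite Ai ?ik.
  by rewrite (utnz_eq0 B jk) !mulr0.
by rewrite (utnz_eq0 A ki) (utnz_eq0 E ki) mulr0 !mul0r.
Qed.

End Triangular.

(** * Size four *)

Section SizeFour.

Variable L : linOrdIdemSemifieldType.
Local Open Scope ring_scope.
Implicit Types A B E : utnz L 4.

Local Notation o0 := (@Ordinal 4 0 isT).
Local Notation o1 := (@Ordinal 4 1 isT).
Local Notation o2 := (@Ordinal 4 2 isT).
Local Notation o3 := (@Ordinal 4 3 isT).

Lemma forall_ord4 (P : 'I_4 -> Prop) :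
  P o0 -> P o1 -> P o2 -> P o3 -> forall i, P i.
Proof.
move=> P0 P1 P2 P3 [[|[|[|[|//]]]] lt];
  [move: P0|move: P1|move: P2|move: P3]; congr P; exact: val_inj.
Qed.

Lemma row_tight_last_col E A i : idempotent_elt E -> row_tight E A ->
  A i o3 = E i o3 * A o3 o3.
Proof.
move=> EE tight; case: (ltnP i o3) => [i3|le3].
  have [k k3 e] := tight i o3 i3.
  have k_o3 : k = o3 by apply/val_inj/eqP; rewrite eqn_leq k3 -ltnS ltn_ord.
  by rewrite k_o3 in e.
have -> : i = o3 by apply/val_inj/eqP; rewrite eqn_leq le3 -ltnS ltn_ord.
by rewrite (idempotent_diag _ EE) mul1r.
Qed.

Lemma col_tight_first_row E A j : idempotent_elt E -> col_tight E A ->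
  A o0 j = A o0 o0 * E o0 j.
Proof.
move=> EE tight; case: (posnP j) => [j0|j0].
  have -> : j = o0 by apply: val_inj.
  by rewrite (idempotent_diag _ EE) mulr1.
have [k k0 e] := tight o0 j j0.
have k_o0 : k = o0 by apply/val_inj/eqP; rewrite -leqn0.
by rewrite k_o0 in e.
Qed.

(** Tightness at (0,1) is where both relations are needed: the dichotomy comes
    from the column condition of the factors at (1,3), since their row
    condition at (0,1) may be witnessed at [k = 2]. *)
Lemma row_tight_mul E A B : idempotent_elt E ->
  tildeH E A -> tildeH E B -> row_tight E (A * B)%g.
Proof.
move=> EE [RA LA] [RB LB].
have AE : (A * E)%g = A by apply/(LA E EE).
have [_ rA] := (tildeR_row_tight A EE).1 RA.
have [EB rB] := (tildeR_row_tight B EE).1 RB.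
have cA := tildeL_col_tight EE LA; have cB := tildeL_col_tight EE LB.
have lastA i := row_tight_last_col i EE rA.
have lastB i := row_tight_last_col i EE rB.
have firstA i := col_tight_first_row i EE cA.
have firstB i := col_tight_first_row i EE cB.
have nz (M : utnz L 4) (i j : 'I_4) : (i <= j)%N -> M i j != 0.
    exact: utnz_neq0.
have corner (M : utnz L 4) : (forall i, M i o3 = E i o3 * M o3 o3) ->
    (forall j, M o0 j = M o0 o0 * E o0 j) -> M o0 o0 = M o3 o3.
  move=> lastM firstM; apply: (semifield_mulIf (nz E o0 o3 isT)).
  by rewrite /= -firstM lastM mulrC.
have cornA := corner A lastA firstA; have cornB := corner B lastB firstB.
have lastAB i : (A * B)%g i o3 = E i o3 * (A * B)%g o3 o3.
  rewrite (mul_prop_col AE) => [|k _]; last exact: lastB.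
  by rewrite utnz_mul_diag lastA mulrA.
have firstAB j : (A * B)%g o0 j = A o0 o0 * B o0 o0 * E o0 j.
  rewrite (mul_prop_row EB) => [|k _]; last exact: firstA.
  by rewrite firstB mulrA.
have by_last (i j : 'I_4) : E i o3 = E i j * E j o3 ->
    exists2 k : 'I_4, (j <= k)%N & (A * B)%g i k = E i j * (A * B)%g j k.
  move=> e; exists o3; first by rewrite -ltnS ltn_ord.
  by rewrite lastAB e -mulrA -lastAB.
have by_first j : A o0 o0 = A j j -> B o0 o0 = B j j ->
    exists2 k : 'I_4, (j <= k)%N & (A * B)%g o0 k = E o0 j * (A * B)%g j k.
  by move=> a b; exists j; rewrite // firstAB utnz_mul_diag a b mulrC.
(* A factor tight at k = 3 forces the corresponding identity on E. *)
have last_tight (M : utnz L 4) i j : (forall i, M i o3 = E i o3 * M o3 o3) ->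
    M i o3 = E i j * M j o3 -> E i o3 = E i j * E j o3.
  move=> lastM e; apply: (semifield_mulIf (nz M o3 o3 isT)) => /=.
  by rewrite -lastM e lastM mulrA.
have dich01 (M : utnz L 4) : col_tight E M ->
    (forall i, M i o3 = E i o3 * M o3 o3) ->
    (forall j, M o0 j = M o0 o0 * E o0 j) ->
    E o0 o3 = E o0 o1 * E o1 o3 \/ M o0 o0 = M o1 o1.
  move=> cM lastM firstM; have [k] := cM o1 o3 isT.
  elim/forall_ord4: k => //= _ e.
    left; apply: (semifield_mulfI (nz M o0 o0 isT)).
    by rewrite -firstM e firstM mulrA.
  right; rewrite (corner M) //; apply: (semifield_mulIf (nz E o1 o3 isT)).
  by rewrite /= -e (lastM o1) mulrC.
have dich02 (M : utnz L 4) : row_tight E M ->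
    (forall i, M i o3 = E i o3 * M o3 o3) ->
    (forall j, M o0 j = M o0 o0 * E o0 j) ->
    E o0 o3 = E o0 o2 * E o2 o3 \/ M o0 o0 = M o2 o2.
  move=> rM lastM firstM; have [k] := rM o0 o2 isT.
  elim/forall_ord4: k => //= _ e; last by left; apply: last_tight e.
  right; apply: (semifield_mulIf (nz E o0 o2 isT)).
  by rewrite /= -firstM e mulrC.
have dich12 (M : utnz L 4) : row_tight E M ->
    (forall i, M i o3 = E i o3 * M o3 o3) ->
    E o1 o3 = E o1 o2 * E o2 o3 \/ M o1 o2 = E o1 o2 * M o2 o2.
  move=> rM lastM; have [k] := rM o1 o2 isT.
  elim/forall_ord4: k => //= _ e; last by left; apply: last_tight e.
  by right.
elim/forall_ord4; elim/forall_ord4=> //= _; try by exists o3.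
- case: (dich01 A) => // [/by_last //|a]; case: (dich01 B) => // [/by_last //|].
  exact: by_first.
- case: (dich02 A) => // [/by_last //|a]; case: (dich02 B) => // [/by_last //|].
  exact: by_first.
- case: (dich12 A) => // [/by_last //|a]; case: (dich12 B) => // [/by_last //|b].
  exists o2 => //; rewrite (mul_prop_col AE) ?a ?utnz_mul_diag ?mulrA //.
  elim/forall_ord4=> //= _.
  by rewrite (idempotent_diag _ EE) mul1r.
Qed.

Lemma tildeR_mul E A B : idempotent_elt E ->
  tildeH E A -> tildeH E B -> tildeR E (A * B)%g.
Proof.
move=> EE HA HB; apply/tildeR_row_tight => //; split.
  by rewrite mulgA (HA.1 E EE).1.
exact: row_tight_mul.
Qed.

End SizeFour.

Theorem proposition7p12 (L : linOrdIdemSemifieldType)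
    (L_neq_B : ~ semiring_iso L boolSemifield)
    (E : utnz L 4) (E_idem : idempotent_elt E) :
  subsemigroup (tildeH_class E).
Proof.
split=> [|A B HA HB]; first by exists E.
split; first exact: tildeR_mul.
apply: tildeL_of_dual; rewrite dualM.
by apply: tildeR_mul; [apply: dual_idempotent|apply: tildeH_dual..].
Qed.
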